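(* Let $\mathcal C,\mathcal D$ be stable configuration structures. Then $\mathcal C$ and $\mathcal D$ are weak history-preserving (WH) bisimilar if and only if $\mathcal C\equiv_{\mathrm{EIL}_{wh}}\mathcal D$.
   Context: Configuration structures. A configuration structure over $\mathsf{Act}$ is $\mathcal C=(C,\ell)$, $C$ a family of finite sets (configurations), $\ell:\bigcup_{X\in C}X\to\mathsf{Act}$. Stable: $\emptyset\in C$; every nonempty $X\in C$ has $e\in X$ with $X\setminus\{e\}\in C$; for $X,Y,Z\in C$ with $X\cup Y\subseteq Z$, $X\cup Y\in C$ and $X\cap Y\in C$. For $X\in C$: $d\le_X e$ iff every $Y\in C$ with $Y\subseteq X$ and $e\in Y$ contains $d$; $d<_Xe$ iff $d\le_Xe$, $d\ne e$. $X\xrightarrow{e}X'$ iff $X,X'\in C$, $X\subseteq X'$, $X'\setminus X=\{e\}$; $X\xrightarrow{a}X'$ iff $X\xrightarrow{e}X'$ with $\ell(e)=a$. Standing assumption: image finiteness. $X\cong Y$ means there is a label-preserving bijection $f:X\to Y$ with $d<_Xe\iff f(d)<_Yf(e)$. WH bisimulation. $\mathcal R\subseteq C_{\mathcal C}\times C_{\mathcal D}$ with $\mathcal R(\emptyset,\emptyset)$ such that whenever $\mathcal R(X,Y)$ and $a\in\mathsf{Act}$: $X\cong Y$; if $X\xrightarrow{a}X'$ then $\exists Y'$, $Y\xrightarrow{a}Y'$, $\mathcal R(X',Y')$; symmetrically for $Y\xrightarrow{a}Y'$. EIL. Syntax $\phi::=\mathrm{tt}\mid\neg\phi\mid\phi\wedge\phi'\mid\langle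 x:a\rangle\phi\mid(x:a)\phi\mid\langle\!\langle x\rangle\!\rangle\phi$; $\langle x:a\rangle,(x:a)$ bind $x$; $\mathrm{fi}(\langle\!\langle x\rangle\!\rangle\phi)=\mathrm{fi}(\phi)\cup\{x\}$, other clauses as usual; closed = no free identifiers. Environment $\rho$ is permissible for $\phi$ and $X$ if $\mathrm{fi}(\phi)\subseteq\mathrm{dom}\rho$, $\rho(\mathrm{fi}(\phi))\subseteq X$. Semantics: $\mathrm{tt}$, $\neg$, $\wedge$ classical; $X,\rho\models\langle x:a\rangle\phi$ iff $\exists X',e$: $X\xrightarrow{e}X'$, $\ell(e)=a$, $X',\rho[x\mapsto e]\models\phi$; $X,\rho\models(x:a)\phi$ iff $\exists e\in X$, $\ell(e)=a$, $X,\rho[x\mapsto e]\models\phi$; $X,\rho\models\langle\!\langle x\rangle\!\rangle\phi$ iff $\exists X',e$: $X'\xrightarrow{e}X$, $\rho(x)=e$, $\rho$ permissible for $\phi$ and $X'$, $X',\rho\models\phi$. For closed $\phi$: $\mathcal C\models\phi$ iff $\emptyset,\emptyset\models\phi$. $\mathcal C\equiv_L\mathcal D$ iff for all closed $\phi\in L$: $\mathcal C\models\phi\iff\mathcal D\models\phi$. Abbreviation: $\langle a\rangle\phi$ stands for $\langle x:a\rangle\phi$ with $x$ not free in $\phi$. Sublogics. $\mathrm{EIL}_{ro}$: $\phi::=\mathrm{tt}\mid\neg\phi\mid\phi\wedge\phi'\mid(x:a)\phi\mid\langle\!\langle x\rangle\!\rangle\phi$. $\mathrm{EIL}_{wh}$: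 $\phi::=\mathrm{tt}\mid\neg\phi\mid\phi\wedge\phi'\mid\langle a\rangle\phi\mid\phi_{rc}$, where $\phi_{rc}$ ranges over closed formulas of $\mathrm{EIL}_{ro}$ (all formulas of $\mathrm{EIL}_{wh}$ are closed). *)

(* Defs.v *)
From mathcomp Require Import all_boot finmap.
From mathcomp Require Import classical_sets cardinality.

Set Implicit Arguments.
Unset Strict Implicit.
Unset Printing Implicit Defensive.

Local Open Scope fset_scope.

(* The labelling of a configuration structure is only meaningful on the events
   of its configurations; it is represented by a total function on the carrier
   type [event], and its values elsewhere are never used.  Classically, every
   type carries a choiceType structure, so [event] is not a restriction. *)
Record confStruct (Act : Type) := ConfStruct {
  event : choiceType;
  conf : set {fset event};
  lab : event -> Act
}.

Arguments conf {Act} C _ : rename.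

Section ConfigurationStructures.
Variables (Act : Type) (C : confStruct Act).
Implicit Types (X Y Z : {fset event C}) (d e : event C) (a : Act).

Definition stable : Prop :=
  [/\ conf C fset0,
      forall X, conf C X -> X != fset0 -> exists2 e, e \in X & conf C (X `\ e)
    & forall X Y Z, conf C X -> conf C Y -> conf C Z -> X `|` Y `<=` Z ->
        conf C (X `|` Y) /\ conf C (X `&` Y)].

Definition cle X d e : Prop :=
  forall Y, conf C Y -> Y `<=` X -> e \in Y -> d \in Y.

Definition clt X d e : Prop := cle X d e /\ d <> e.

Definition etrans X e X' : Prop :=
  [/\ conf C X, conf C X', X `<=` X' & X' `\` X = [fset e]].

Definition atrans X a X' : Prop := exists2 e, etrans X e X' & lab e = a.

Definition image_finite : Prop :=
  forall X a, conf C X -> finite_set [set X' | atrans X a X']%classic.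

End ConfigurationStructures.

Definition conf_iso (Act : Type) (C D : confStruct Act)
    (X : {fset event C}) (Y : {fset event D}) : Prop :=
  exists f : X -> Y,
    [/\ bijective f,
        forall d : X, lab (val (f d)) = lab (val d)
      & forall d e : X,
          clt X (val d) (val e) <-> clt Y (val (f d)) (val (f e))].

Definition WH_bisimulation (Act : Type) (C D : confStruct Act)
    (R : {fset event C} -> {fset event D} -> Prop) : Prop :=
  [/\ forall X Y, R X Y -> conf C X /\ conf D Y,
      R fset0 fset0
    & forall X Y, R X Y -> forall a : Act,
        [/\ conf_iso X Y,
            forall X', atrans X a X' -> exists2 Y', atrans Y a Y' & R X' Y'
          & forall Y', atrans Y a Y' -> exists2 X', atrans X a X' & R X' Y']].

Definition WH_bisimilar (Act : Type) (C D : confStruct Act) : Prop :=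
  exists R, @WH_bisimulation Act C D R.

(* [Dia x a phi] is <x:a>phi, [Decl x a phi] is (x:a)phi and [Rev x phi] is
   <<x>>phi. *)
Inductive EIL (Act : Type) (Id : choiceType) : Type :=
| TT
| Neg of EIL Act Id
| And of EIL Act Id & EIL Act Id
| Dia of Id & Act & EIL Act Id
| Decl of Id & Act & EIL Act Id
| Rev of Id & EIL Act Id.

Arguments TT {Act Id}.

Section Logic.
Variables (Act : Type) (Id : choiceType).
Implicit Types (phi psi : EIL Act Id) (x : Id) (a : Act).

Fixpoint fi phi : {fset Id} :=
  match phi with
  | TT => fset0
  | Neg phi => fi phi
  | And phi psi => fi phi `|` fi psi
  | Dia x _ phi => fi phi `\ x
  | Decl x _ phi => fi phi `\ x
  | Rev x phi => x |` fi phi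
  end.

Definition closed phi : Prop := fi phi = fset0.

Inductive EIL_ro : EIL Act Id -> Prop :=
| ro_TT : EIL_ro TT
| ro_Neg phi : EIL_ro phi -> EIL_ro (Neg phi)
| ro_And phi psi : EIL_ro phi -> EIL_ro psi -> EIL_ro (And phi psi)
| ro_Decl x a phi : EIL_ro phi -> EIL_ro (Decl x a phi)
| ro_Rev x phi : EIL_ro phi -> EIL_ro (Rev x phi).

Inductive EIL_wh : EIL Act Id -> Prop :=
| wh_TT : EIL_wh TT
| wh_Neg phi : EIL_wh phi -> EIL_wh (Neg phi)
| wh_And phi psi : EIL_wh phi -> EIL_wh psi -> EIL_wh (And phi psi)
| wh_Dia x a phi : x \notin fi phi -> EIL_wh phi -> EIL_wh (Dia x a phi)
| wh_rc phi : EIL_ro phi -> closed phi -> EIL_wh phi.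

Section Semantics.
Variable C : confStruct Act.
Implicit Types (X : {fset event C}) (e : event C).

(* Partial maps from identifiers to events. *)
Definition env := Id -> option (event C).

Definition env0 : env := fun=> None.

Definition upd (rho : env) x e : env :=
  fun y => if y == x then Some e else rho y.

Definition permissible (rho : env) phi X : Prop :=
  forall x, x \in fi phi -> exists2 e, rho x = Some e & e \in X.

(* Only meaningful when [rho] is permissible for the formula and [X]. *)
Fixpoint sat X (rho : env) phi : Prop :=
  match phi with
  | TT => True
  | Neg phi => ~ sat X rho phi
  | And phi psi => sat X rho phi /\ sat X rho psi
  | Dia x a phi =>
      exists X' e, [/\ etrans X e X', lab e = a & sat X' (upd rho x e) phi]
  | Decl x a phi =>
      exists e, [/\ e \in X, lab e = a & sat X (upd rho x e) phi]
  | Rev x phi =>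
      exists X' e, [/\ etrans X' e X, rho x = Some e,
                       permissible rho phi X' & sat X' rho phi]
  end.

Definition models phi : Prop := sat fset0 env0 phi.

End Semantics.

Definition logic_equiv (L : EIL Act Id -> Prop) (C D : confStruct Act) : Prop :=
  forall phi, L phi -> closed phi -> (models C phi <-> models D phi).

End Logic.

(* Main.v *)
(* A sub-configuration of X is a down-closed subset of X for the causal order
   of X, so an isomorphism of configurations is preserved when matching events
   are reversed; hence EIL_ro formulas are invariant under isomorphism, and
   EIL_wh formulas under WH bisimulation.

   Conversely, the causal order of X is determined by the sequences of events
   that can be successively reversed from X.  If a map f : X -> Y does not
   preserve and reflect these sequences, a formula <<x1>>...<<xn>>tt or its
   negation tells X and Y apart.  As there are finitely many such maps, the
   conjunction of these formulas under the binders (x:a), one for each event of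
   X, shows that logically equivalent X and Y admit a label-preserving f that
   preserves and reflects reversals; it is injective since X can be emptied.  By
   symmetry X and Y have the same cardinality, so that f is an isomorphism.
   Transitions are matched by image finiteness, as for Hennessy-Milner logic. *)

Require Import Defs.
From mathcomp Require Import all_boot finmap.
From mathcomp Require Import boolp classical_sets cardinality.
(* Restores [Defs.etrans], shadowed by the [etrans] of ssrfun. *)
Import Defs.
(* Restores [Defs.etrans], shadowed by the [etrans] of ssrfun. *)
Import Defs.
(* Restores [Defs.etrans], shadowed by the [etrans] of ssrfun. *)
Import Defs.
(* Restores [Defs.etrans], shadowed by the [etrans] of ssrfun. *)
Import Defs.

Set Implicit Arguments.
Unset Strict Implicit.
Unset Printing Implicit Defensive.

Local Open Scope fset_scope.

(** * Causal order and reversible sequences in a stable structure *)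

Section CausalOrder.
Variables (Act : Type) (C : confStruct Act).
Hypothesis stableC : stable C.
Implicit Types (X Y Z : {fset event C}) (d e : event C) (s : seq (event C)).

Lemma conf0 : conf C fset0. Proof. by case: stableC. Qed.

Lemma confU X Y Z : conf C X -> conf C Y -> conf C Z -> X `<=` Z -> Y `<=` Z ->
  conf C (X `|` Y).
Proof.
move=> cX cY cZ XZ YZ; case: stableC => _ _ /(_ X Y Z cX cY cZ) H.
by apply: (proj1 (H _)); rewrite fsubUset XZ.
Qed.

Lemma confI X Y Z : conf C X -> conf C Y -> conf C Z -> X `<=` Z -> Y `<=` Z ->
  conf C (X `&` Y).
Proof.
move=> cX cY cZ XZ YZ; case: stableC => _ _ /(_ X Y Z cX cY cZ) H.
by apply: (proj2 (H _)); rewrite fsubUset XZ.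
Qed.

Lemma etransE X e X' :
  etrans X' e X <-> [/\ conf C X, conf C X', e \in X & X' = X `\ e].
Proof.
split=> [[cX' cX sub dif]|[cX cX' eX X'E]].
  have eX : e \in X `\` X' by rewrite dif in_fset1.
  split=> //; first by move: eX; rewrite inE => /andP[].
  by rewrite -dif fsetDDr fsetDv fset0U; rewrite (fsetIidPr sub).
rewrite X'E in cX' *; split=> //; first exact: fsubsetDl.
by rewrite fsetDDr fsetDv fset0U; apply/fsetIidPr; rewrite fsub1set.
Qed.

(** Stability: a sub-configuration [Y] of [X] containing [e] can be cut down to [Y] ∩ [X'], which is
    again a configuration. *)
Lemma cle_sub X X' d e : conf C X -> conf C X' -> X' `<=` X -> e \in X' ->
  cle X' d e <-> cle X d e.
Proof.
move=> cX cX' sub eX'; split=> H Y cY YX eY.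
  have: d \in Y `&` X'.
    apply: H; [exact: confI cY cX' cX YX sub|exact: fsubsetIr|].
    by rewrite inE eY.
  by rewrite inE => /andP[].
by apply: H => //; apply: fsubset_trans sub.
Qed.

(** If [d] is maximal, every other event of [X] lies in a sub-configuration avoiding [d]; the union
    of these finitely many configurations is [X] without [d]. *)
Lemma conf_fsetD1 X d : conf C X ->
  conf C (X `\ d) <-> forall e, e \in X -> cle X d e -> d = e.
Proof.
move=> cX; split=> [cXd e eX le_de|dmax].
  apply/eqP/negPn/negP => de.
  have: d \in X `\ d.
    by apply: le_de => //; [exact: fsubsetDl|rewrite !inE eq_sym de].
  by rewrite !inE eqxx.
have cover s : {subset s <= X `\ d} ->
    exists Z, [/\ conf C Z, Z `<=` X, d \notin Z & {subset s <= Z}].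
  elim: s => [|e s IH] sX; first by exists fset0; split=> //; exact: conf0.
  have [|Z [cZ ZX dZ sZ]] := IH.
    by move=> x xs; apply: sX; rewrite inE xs orbT.
  have: e \in X `\ d by apply: sX; rewrite inE eqxx.
  rewrite !inE => /andP[ed eX].
  have /existsNP[Y] : ~ cle X d e by move=> /(dmax e eX) E; rewrite E eqxx in ed.
  move=> /not_implyP[cY] /not_implyP[YX] /not_implyP[eY] /negP dY.
  exists (Z `|` Y); split.
  - exact: confU cX ZX YX.
  - by rewrite fsubUset ZX.
  - by rewrite inE negb_or dZ.
  - by move=> x; rewrite !inE => /predU1P[->|/sZ ->//]; rewrite eY orbT.
have [Z [cZ ZX dZ sZ]] := cover (X `\ d) (fun _ => id).
suff -> : X `\ d = Z by [].
by apply/eqP; rewrite eqEfsubset fsubsetD1 ZX dZ !andbT; apply/fsubsetP.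
Qed.

Fixpoint reversible X s : Prop :=
  if s is d :: s' then [/\ conf C (X `\ d), d \in X & reversible (X `\ d) s']
  else True.

Lemma reversible_sub X s : reversible X s -> {subset s <= X}.
Proof.
elim: s X => //= d s IH X [_ dX /IH sX] e.
by rewrite inE => /predU1P[->//|/sX]; rewrite !inE => /andP[].
Qed.

Lemma reversible_uniq X s : reversible X s -> uniq s.
Proof.
elim: s X => //= d s IH X [_ _ rs]; rewrite (IH _ rs) andbT.
by apply/negP => /(reversible_sub rs); rewrite !inE eqxx.
Qed.

Lemma reversible_conf X s : conf C X -> reversible X s ->
  exists2 Z, conf C Z & Z =i [predD X & s].
Proof.
elim: s X => [|d s IH] X cX /=; first by exists X.
case=> cXd _ /(IH _ cXd) [Z cZ ZE]; exists Z => // e.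
by rewrite ZE !inE negb_or; case: (e == d); rewrite ?andbF.
Qed.

Lemma emptying X : conf C X -> exists2 s, reversible X s & s =i X.
Proof.
have [n] := ubnP #|` X|; elim: n X => // n IH X ltn cX.
have [->|nX] := eqVneq X fset0; first by exists [::].
case: stableC => _ /(_ X cX nX) [d dX cXd] _.
have [|s rs sE] := IH _ _ cXd.
  by rewrite (cardfsD1 d) dX in ltn.
exists (d :: s) => //= e; rewrite inE sE !inE.
by have [->|] := eqVneq e d.
Qed.

(** Take a sequence emptying [X] and skip the events of [Z]: each configuration on the way is
    replaced by its union with [Z], a configuration by stability. *)
Lemma reversible_to X Z : conf C X -> conf C Z -> Z `<=` X ->
  exists2 s, reversible X s & s =i X `\` Z.
Proof.
move=> cX cZ ZX.
have rev_filter s W : conf C W -> W `<=` X -> reversible W s ->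
    reversible (W `|` Z) [seq d <- s | d \notin Z].
  elim: s W => //= d s IH W cW WX [cWd dW rs].
  have WdX : W `\ d `<=` X by apply: fsubset_trans WX; exact: fsubsetDl.
  have [dZ|dZ] /= := boolP (d \in Z).
    have -> : W `|` Z = (W `\ d) `|` Z; last exact: IH.
    apply/fsetP => e; rewrite !inE.
    by have [->|] := eqVneq e d; rewrite ?dZ ?orbT.
  have -> : (W `|` Z) `\ d = (W `\ d) `|` Z.
    apply/fsetP => e; rewrite !inE.
    by have [->|] := eqVneq e d; rewrite ?(negbTE dZ).
  by split; [exact: confU cX WdX ZX|rewrite inE dW|exact: IH].
have [s rs sE] := emptying cX.
exists [seq d <- s | d \notin Z]; last by move=> e; rewrite mem_filter sE inE.
have -> : X = X `|` Z by apply/esym/fsetUidPl.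
exact: rev_filter.
Qed.

(** The sub-configurations of [X] are exactly what reversible sequences leave behind, so the
    definition of [cle] can be read on the removed events, by contraposition. *)
Lemma cle_reversible X d e : conf C X -> d \in X -> e \in X ->
  cle X d e <-> forall s, reversible X s -> d \in s -> e \in s.
Proof.
move=> cX dX eX; split=> [le_de s rs ds|H Z cZ ZX eZ].
  have [Z cZ ZE] := reversible_conf cX rs.
  apply/negPn/negP => es.
  have: d \in Z.
    apply: le_de => //; last by rewrite ZE inE /= es.
    by apply/fsubsetP => x; rewrite ZE inE => /andP[].
  by rewrite ZE inE /= ds.
have [s rs sE] := reversible_to cX cZ ZX.
apply/negPn/negP => dZ; have := H s rs.
by rewrite !sE !inE dZ dX eZ => /(_ isT).
Qed.

End CausalOrder.

(** * Invariance of the logics under isomorphism and WH bisimulation *)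

Section Invariance.
Variable Act : Type.

(* The relational form of [conf_iso]: restricting it to sub-configurations
   leaves [g] unchanged. *)
Definition iso_by (C D : confStruct Act) (X : {fset event C})
    (Y : {fset event D}) (g : event C -> event D -> Prop) : Prop :=
  [/\ conf C X /\ conf D Y,
      forall d, d \in X -> exists2 e, e \in Y & g d e,
      forall e, e \in Y -> exists2 d, d \in X & g d e,
      forall d e, d \in X -> e \in Y -> g d e -> lab d = lab e
    & forall d d' e e', d \in X -> d' \in X -> e \in Y -> e' \in Y ->
        g d e -> g d' e' ->
        (d = d' <-> e = e') /\ (cle X d d' <-> cle Y e e')].

Lemma iso_by_sym (C D : confStruct Act) (X : {fset event C})
    (Y : {fset event D}) g : iso_by X Y g -> iso_by Y X (fun e d => g d e).
Proof.
case=> [[cX cY]] total surj labg ordg; split=> //.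
  by move=> e d eY dX gde; rewrite (labg d e).
move=> e e' d d' eY e'Y dX d'X g1 g2.
have [inj ord] := ordg d d' e e' dX d'X eY e'Y g1 g2.
by split; apply: iff_sym.
Qed.

Lemma conf_iso_by (C D : confStruct Act) (X : {fset event C})
    (Y : {fset event D}) : conf C X -> conf D Y -> conf_iso X Y ->
  exists g, iso_by X Y g.
Proof.
move=> cX cY [f [[f' fK f'K] labf ordf]].
exists (fun d e => exists2 d' : X, val d' = d & val (f d') = e); split=> //.
- by move=> d dX; exists (val (f [` dX])); [exact: valP|exists [` dX]].
- move=> e eY; exists (val (f' [` eY])); first exact: valP.
  by exists (f' [` eY]) => //; rewrite f'K.
- by move=> _ _ _ _ [d <- <-]; rewrite labf.
- move=> _ _ _ _ _ _ _ _ [d <- <-] [d' <- <-].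
  have inj : val d = val d' <-> val (f d) = val (f d').
    by split=> [/val_inj -> //|/val_inj /(can_inj fK) ->].
  (* [clt] says nothing about equal events; for these both sides hold by reflexivity of [cle]. *)
  split=> //; have [/[dup] Ed /inj Ef|nd] := pselect (val d = val d').
    by rewrite Ed Ef; split=> _ ?.
  have [oF oG] := ordf d d'; split=> le.
    by have [] := oF (conj le nd).
  by have [] := oG (conj le (fun E => nd ((proj2 inj) E))).
Qed.

(** Being removable means being causally maximal, which [g] transports from [d] to [e]; by [cle_sub]
    the smaller configurations inherit their causal orders. *)
Lemma iso_by_fsetD1 (C D : confStruct Act) (X : {fset event C})
    (Y : {fset event D}) g d e : stable C -> stable D -> iso_by X Y g ->
  d \in X -> e \in Y -> g d e -> conf C (X `\ d) ->
  iso_by (X `\ d) (Y `\ e) g.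
Proof.
move=> sC sD [[cX cY]] total surj labg ordg dX eY gde cXd.
have cYe : conf D (Y `\ e).
  apply/(conf_fsetD1 sD _ cY) => e' e'Y le_ee'.
  have [d' d'X gde'] := surj e' e'Y.
  have [inj ord] := ordg d d' e e' dX d'X eY e'Y gde gde'.
  by apply/inj; apply: (proj1 (conf_fsetD1 sC d cX)) => //; apply/ord.
have neq d' e' : d' \in X -> e' \in Y -> g d' e' -> (d' == d) = (e' == e).
  move=> d'X e'Y gde'.
  have [inj _] := ordg d' d e' e d'X dX e'Y eY gde' gde.
  by apply/eqP/eqP => /inj.
split=> //.
- move=> d'; rewrite !inE => /andP[nd d'X].
  have [e' e'Y gde'] := total d' d'X; exists e' => //.
  by rewrite !inE -(neq d') // nd.
- move=> e'; rewrite !inE => /andP[ne e'Y].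
  have [d' d'X gde'] := surj e' e'Y; exists d' => //.
  by rewrite !inE (neq d' e') // ne.
- by move=> d' e' /fsetD1P[_ ?] /fsetD1P[_ ?]; apply: labg.
- move=> d1 d2 e1 e2 d1X d2X e1Y e2Y g1 g2.
  rewrite (cle_sub sC d1 cX cXd) ?fsubsetDl //.
  rewrite (cle_sub sD e1 cY cYe) ?fsubsetDl //.
  move: d1X d2X e1Y e2Y => /fsetD1P[_ ?] /fsetD1P[_ ?] /fsetD1P[_ ?] /fsetD1P[_ ?].
  exact: ordg.
Qed.

Variable Id : choiceType.
Implicit Types (phi : EIL Act Id).

(** One implication suffices as induction hypothesis: the case of [Neg] applies it to the inverse
    isomorphism, since all structures are quantified. *)
Lemma ro_invariant phi : EIL_ro phi ->
  forall (C D : confStruct Act) (X : {fset event C}) (Y : {fset event D}) g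
    (rho : env Id C) (rho' : env Id D),
  stable C -> stable D -> iso_by X Y g ->
  (forall x, x \in fi phi -> exists d e,
     [/\ rho x = Some d, rho' x = Some e, d \in X, e \in Y & g d e]) ->
  sat X rho phi -> sat Y rho' phi.
Proof.
elim=> {phi} [|phi _ IH|phi psi _ IH1 _ IH2|x a phi _ IH|x phi _ IH]
  C D X Y g rho rho' sC sD iso env_rel //=.
- move=> nX satY; apply: nX.
  apply: (IH D C Y X (fun e d => g d e) rho') => //; first exact: iso_by_sym.
  by move=> x /env_rel[d [e [? ? ? ? ?]]]; exists e, d.
- case=> s1 s2; split.
    by apply: IH1 s1 => // [|x xf]; [exact: iso|apply: env_rel; rewrite inE xf].
  apply: IH2 s2 => // [|x xf]; [exact: iso|].
  by apply: env_rel; rewrite inE xf orbT.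
- case=> d [dX ld sd]; have [_ total _ labg _] := iso.
  have [e eY gde] := total d dX; exists e; split=> //.
    by rewrite -(labg d e).
  apply: IH sd => // [|y yf]; [exact: iso|rewrite /upd].
  have [_|yx] := eqVneq y x; first by exists d, e.
  by apply: env_rel; rewrite !inE yx.
- case=> X' [d [/etransE [cX cXd dX X'E] rx perm sX]].
  have [d0 [e [rx0 rx' _ eY gde]]] := env_rel x (fset1U1 _ _).
  rewrite X'E in cXd perm sX; move: rx0; rewrite rx => -[dd0]; rewrite -dd0 in gde => {d0 dd0}.
  have iso' := iso_by_fsetD1 sC sD iso dX eY gde cXd.
  have [[_ cY'] _ _ _ _] := iso'.
  have [[_ cY] _ _ _ ordg] := iso.
  have env_rel' y : y \in fi phi -> exists d' e',
      [/\ rho y = Some d', rho' y = Some e', d' \in X `\ d, e' \in Y `\ e & g d' e'].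
    move=> yf; have [|d' [e' [ry ry' d'X e'Y gde']]] := env_rel y.
      by rewrite !inE yf orbT.
    (* Permissibility for the smaller configuration shows that [d'] differs from the reversed [d],
       hence [e'] from [e]. *)
    have [d'' ry2 d''X] := perm y yf.
    move: ry2; rewrite ry => -[E]; rewrite -E in d''X.
    exists d', e'; split=> //; rewrite !inE e'Y andbT.
    apply/eqP => ee; have [inj _] := ordg d' d e' e d'X dX e'Y eY gde' gde.
    by move: d''X; rewrite (proj2 inj ee) !inE eqxx.
  exists (Y `\ e), e; split=> //.
  + by apply/etransE.
  + by move=> y /env_rel'[d' [e' []]]; exists e'.
  + by apply: IH sX; [..|exact: iso'|exact: env_rel'].
Qed.

(** Quantifying over unrelated environments absorbs the update made by [Dia]; the closed [EIL_ro]
    formulas do not depend on theirs. *)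
Lemma wh_invariant (C D : confStruct Act) (sC : stable C) (sD : stable D) R phi :
  @WH_bisimulation Act C D R -> EIL_wh phi ->
  forall X Y rho rho', R X Y -> sat X rho phi <-> sat Y rho' phi.
Proof.
case=> Rconf _ Rstep; elim=> {phi} [|phi _ IH|phi psi _ IH1 _ IH2|x a phi _ _ IH|phi ro cl]
  X Y rho rho' RXY //=.
- by rewrite (IH X Y rho rho').
- by rewrite (IH1 X Y rho rho') // (IH2 X Y rho rho').
- have [_ fwd bwd] := Rstep X Y RXY a; split=> [[X' [d [tr ld s]]]|[Y' [e [tr le s]]]].
    have [|Y' [e tr' le] RXY'] := fwd X'; first by exists d.
    by exists Y', e; split=> //; apply: (proj1 (IH _ _ _ _ RXY')) s.
  have [|X' [d tr' ld] RXY'] := bwd Y'; first by exists e.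
  by exists X', d; split=> //; apply: (proj2 (IH _ _ _ _ RXY')) s.
- have [cX cY] := Rconf X Y RXY.
  have noid x : x \in fi phi -> False by rewrite cl inE.
  (* [Rstep] yields an isomorphism only when there is an action; otherwise
     there are no events either. *)
  have [[a _]|noact] := pselect (exists a : Act, True); last first.
    have X0 : forall d, d \notin X by move=> d; case: noact; exists (lab d).
    have Y0 : forall d, d \notin Y by move=> d; case: noact; exists (lab d).
    have iso : iso_by X Y (fun _ _ => True).
      by split=> // [d|d|d e|d d' e e'] dX;
        rewrite ?(negbTE (X0 _)) ?(negbTE (Y0 _)) in dX.
    split; apply: ro_invariant => //.
    + exact: iso.
    + by move=> x /noid.
    + exact: (iso_by_sym iso).
    + by move=> x /noid.
  have [/(conf_iso_by cX cY)[g iso] _ _] := Rstep X Y RXY a.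
  split; apply: ro_invariant => //.
  + exact: iso.
  + by move=> x /noid.
  + exact: (iso_by_sym iso).
  + by move=> x /noid.
Qed.

End Invariance.

(** * Separating formulas and the label-preserving reversal maps they yield *)

Lemma seq_preimage (T U : eqType) (h : T -> U) (s : seq U) :
  (forall u, u \in s -> exists t, h t = u) -> exists s', map h s' = s.
Proof.
elim: s => [|u s IH] hs; first by exists [::].
have [t <-] := hs u (mem_head _ _).
have [|s' <-] := IH; first by move=> v vs; apply: hs; rewrite inE vs orbT.
by exists (t :: s').
Qed.

(** Supplies distinct identifiers naming the events of a configuration. *)
Lemma infinite_injection (T : finType) (U : choiceType) :
  infinite_set [set: U]%classic -> exists iota : T -> U, injective iota.
Proof.
move=> infU; have [B _] := infinite_set_fset #|T| infU.
rewrite cardfE => leTB.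
exists (fun t => val (enum_val (widen_ord leTB (enum_rank t)))).
by move=> t u /val_inj /enum_val_inj /(congr1 val) /= /val_inj /enum_rank_inj.
Qed.

Section Separation.
Variables (Act : Type) (Id : choiceType).
Implicit Types (phi psi : EIL Act Id).

(** The conjunction of one refuting formula per candidate refutes them all. The candidates will be
    the maps between two configurations, and later the successors of a configuration. *)
Lemma conj_separation (T : eqType) (P : EIL Act Id -> Prop)
    (Q : T -> EIL Act Id -> Prop) (s : seq T) :
  P TT -> (forall phi psi, P phi -> P psi -> P (And phi psi)) ->
  (forall t phi psi, Q t (And phi psi) -> Q t phi /\ Q t psi) ->
  (forall t, t \in s -> exists2 phi, P phi & ~ Q t phi) ->
  exists2 phi, P phi & forall t, t \in s -> ~ Q t phi.
Proof.
move=> PT PA QA; elim: s => [|t s IH] sep; first by exists TT.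
have [phi Pphi nQ] := sep t (mem_head _ _).
have [|psi Ppsi nQs] := IH; first by move=> u us; apply: sep; rewrite inE us orbT.
exists (And phi psi); first exact: PA.
by move=> u; rewrite inE => /predU1P[->|/nQs nQu] /QA[].
Qed.

Fixpoint revs (s : seq Id) : EIL Act Id :=
  if s is x :: s' then Rev x (revs s') else TT.

Lemma ro_revs s : EIL_ro (revs s). Proof. by elim: s => /=; constructor. Qed.

Lemma fi_revs s : fi (revs s) =i s.
Proof. by elim: s => //= y s IH x; rewrite !inE IH. Qed.

(** The permissibility required by [Rev] comes for free: events still to be reversed belong to the
    current configuration. *)
Lemma sat_revs (C : confStruct Act) (T : eqType) (iota : T -> Id)
    (h : T -> event C) (rho : env Id C) X (s : seq T) :
  conf C X -> (forall t, rho (iota t) = Some (h t)) ->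
  sat X rho (revs (map iota s)) <-> reversible X (map h s).
Proof.
move=> + rhoE; elim: s X => //= t s IH X cX; split.
  case=> X' [e [/etransE [_ cX' eX X'E]]]; rewrite rhoE => -[E] _ sX'.
  by subst X' e; split=> //; apply: (proj1 (IH _ cX')).
case=> cX' hX rX'; exists (X `\ h t), (h t); split=> //.
- by apply/etransE.
- move=> x; rewrite fi_revs => /mapP[u us ->]; exists (h u) => //.
  by apply: (reversible_sub rX'); exact: map_f.
- exact: (proj2 (IH _ cX')).
Qed.

Fixpoint decls (s : seq (Id * Act)) phi : EIL Act Id :=
  if s is (x, a) :: s' then Decl x a (decls s' phi) else phi.

Lemma ro_decls s phi : EIL_ro phi -> EIL_ro (decls s phi).
Proof. by move=> ro; elim: s => //= -[x a] s IH; constructor. Qed.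

Lemma fi_decls s phi x :
  x \in fi (decls s phi) -> x \in fi phi /\ x \notin map fst s.
Proof.
elim: s => //= -[y a] s IH; rewrite !inE negb_or => /andP[/= -> /IH[-> ->]].
by [].
Qed.

(** Distinct identifiers keep an inner binder from overwriting the choice of an outer one. *)
Lemma sat_decls (C : confStruct Act) (T : eqType) (iota : T -> Id)
    (l : T -> Act) (X : {fset event C}) (rho : env Id C) (s : seq T) phi :
  uniq (map iota s) ->
  sat X rho (decls [seq (iota t, l t) | t <- s] phi) ->
  exists rho', [/\ sat X rho' phi,
    forall t, t \in s -> exists e, [/\ rho' (iota t) = Some e, e \in X & lab e = l t]
    & forall x, x \notin map iota s -> rho' x = rho x].
Proof.
elim: s rho => [|t s IH] rho /=; first by exists rho.
case/andP=> ts us [e [eX le /(IH _ us)[rho' [sX rs rx]]]].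
exists rho'; split=> // [u|x].
  rewrite inE => /predU1P[->|/rs //]; exists e; split=> //.
  by rewrite rx // /upd eqxx.
by rewrite inE negb_or => /andP[xt xs]; rewrite rx // /upd (negbTE xt).
Qed.

Lemma decls_sat (C : confStruct Act) (T : eqType) (iota : T -> Id)
    (h : T -> event C) (X : {fset event C}) (rho : env Id C) (s : seq T) phi :
  uniq (map iota s) -> (forall t, t \in s -> h t \in X) ->
  (forall rho', (forall t, t \in s -> rho' (iota t) = Some (h t)) ->
     (forall x, x \notin map iota s -> rho' x = rho x) -> sat X rho' phi) ->
  sat X rho (decls [seq (iota t, lab (h t)) | t <- s] phi).
Proof.
elim: s rho => [|t s IH] /= rho; first by move=> _ _; apply.
case/andP=> ts us hX sX; exists (h t); split=> //; first exact/hX/mem_head.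
apply: IH => // [u us'|rho' rs rx]; first by apply: hX; rewrite inE us' orbT.
apply: sX => [u|x].
  by rewrite inE => /predU1P[->|/rs //]; rewrite rx // /upd eqxx.
by rewrite inE negb_or => /andP[xt xs]; rewrite rx // /upd (negbTE xt).
Qed.

Definition reversal_map (C D : confStruct Act) (X : {fset event C})
    (Y : {fset event D}) (f : X -> Y) : Prop :=
  forall s : seq X, reversible X (map val s) <-> reversible Y [seq val (f d) | d <- s].

Definition wh_equiv (C D : confStruct Act) (X : {fset event C})
    (Y : {fset event D}) : Prop :=
  [/\ conf C X, conf D Y & forall phi, EIL_wh phi ->
    sat X (env0 C) phi <-> sat Y (env0 D) phi].

Lemma wh_equiv_sym (C D : confStruct Act) (X : {fset event C})
    (Y : {fset event D}) : wh_equiv X Y -> wh_equiv Y X.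
Proof. by case=> cX cY eqv; split=> // phi /eqv; apply: iff_sym. Qed.

Lemma wh_equiv_reversal_map (C D : confStruct Act) (X : {fset event C})
    (Y : {fset event D}) : infinite_set [set: Id]%classic -> wh_equiv X Y ->
  exists2 f : X -> Y, reversal_map f & forall d, lab (val (f d)) = lab (val d).
Proof.
move=> infId [cX cY eqv].
have [iota inj] := @infinite_injection X Id infId.
have [//|none] := pselect (exists2 f : X -> Y, reversal_map f &
  forall d, lab (val (f d)) = lab (val d)).
(* [P] collects the formulas true in [X] when [iota d] names [d]; [Q f] those true in [Y] when
   [iota d] names [f d], for label-preserving [f]. *)
pose P phi := [/\ EIL_ro phi, {subset fi phi <= codom iota} & forall rho : env Id C,
  (forall d, rho (iota d) = Some (val d)) -> sat X rho phi].
pose Q (f : {ffun X -> Y}) phi := (forall d, lab (val (f d)) = lab (val d)) /\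
  exists2 rho : env Id D, forall d, rho (iota d) = Some (val (f d)) & sat Y rho phi.
have fi_in s : {subset fi (revs (map iota s)) <= codom iota}.
  by move=> x; rewrite fi_revs => /mapP[d _ ->]; exact: codom_f.
have [||f phi psi||phi [ro fiphi satX] nQ] :=
    @conj_separation {ffun X -> Y} P Q (enum {ffun X -> Y}).
- by split=> //; constructor.
- move=> phi psi [ro1 fi1 s1] [ro2 fi2 s2]; split; first by constructor.
    by move=> x /=; rewrite inE => /orP[/fi1|/fi2].
  by move=> rho rhoE; split; [exact: s1|exact: s2].
- by case=> labf [rho rhoE [? ?]]; split; split=> //; exists rho.
- move=> f _.
  (* If [f] breaks a label, [Q f] is false of every formula, so [TT] will do. *)
  have [labf|nlab] := pselect (forall d, lab (val (f d)) = lab (val d)); last first.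
    by exists TT; [split=> //; constructor|case].
  have [s nrev] : exists s : seq X, ~ (reversible X (map val s) <->
      reversible Y [seq val (f d) | d <- s]).
    by apply/existsNP => rev; apply: none; exists f.
  have satX rho := @sat_revs C _ iota val rho X s cX.
  have satY rho := @sat_revs D _ iota (fun d => val (f d)) rho Y s cY.
  have [rX|nrX] := pselect (reversible X (map val s)).
    exists (revs (map iota s)).
      by split=> [||rho rhoE]; [exact: ro_revs|exact: fi_in|exact/(satX rho)].
    by case=> _ [rho rhoE /(satY rho rhoE) rY]; apply: nrev.
  exists (Neg (revs (map iota s))).
    split=> [||rho rhoE /(satX rho rhoE)//]; last exact: fi_in.
    by constructor; exact: ro_revs.
  case=> _ [rho rhoE /= nsY]; apply: nrev; split=> // rY.
  by case: nsY; apply/(satY rho).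
have us : uniq (map iota (enum {: X})) by rewrite map_inj_uniq // enum_uniq.
pose chi := decls [seq (iota d, lab (val d)) | d <- enum {: X}] phi.
have wh_chi : EIL_wh chi.
  apply: wh_rc; first exact: ro_decls.
  apply/fsetP => x; rewrite inE; apply/negP => /fi_decls[/fiphi /codomP[d ->]].
  by rewrite -map_comp map_f // mem_enum.
(* In [X] each event is its own witness. The witnesses that [Y] must then provide form a
   label-preserving map for which [phi] holds, although [phi] refutes every map. *)
have /(eqv chi wh_chi) : sat X (env0 C) chi.
  apply: decls_sat => // [d _|rho rhoE _]; first exact: valP.
  by apply: satX => d; apply: rhoE; rewrite mem_enum.
move=> /(sat_decls us)[rho [sY rhoE _]].
have /choice[f fE] d : exists e : Y,
    rho (iota d) = Some (val e) /\ lab (val e) = lab (val d).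
  have [|e [re eY le]] := rhoE d; first by rewrite mem_enum.
  by exists [` eY].
case: (nQ (finfun f)); first by rewrite mem_enum.
split=> [d|]; first by rewrite ffunE; case: (fE d).
by exists rho => // d; rewrite ffunE; case: (fE d).
Qed.

End Separation.

(** * From reversal maps to isomorphisms *)

Section Isomorphism.
Variables (Act : Type) (C D : confStruct Act).
Hypotheses (stableC : stable C) (stableD : stable D).
Variables (X : {fset event C}) (Y : {fset event D}).
Hypotheses (cX : conf C X) (cY : conf D Y).

(** A sequence emptying [X] lists all its events; its image is reversible, hence free of
    repetitions. *)
Lemma reversal_map_inj (f : X -> Y) : reversal_map f -> injective f.
Proof.
move=> rev; have [s rs sE] := emptying stableC cX.
have [|s' s'E] := @seq_preimage X _ val s.
  by move=> d; rewrite sE => dX; exists [` dX].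
have s'T d : d \in s'.
  by rewrite -(mem_map val_inj) s'E sE; exact: valP.
have : uniq [seq val (f d) | d <- s'].
  by apply: (@reversible_uniq _ _ Y); apply/rev; rewrite s'E.
rewrite (map_comp val f) (map_inj_uniq val_inj) => uf.
apply/injectiveP; rewrite /injectiveb /dinjectiveb -(@perm_uniq _ (map f s')) //.
apply/perm_map/uniq_perm; [exact: map_uniq uf|exact: enum_uniq|].
by move=> d; rewrite s'T mem_enum.
Qed.

Lemma reversal_map_cle (f : X -> Y) : reversal_map f -> bijective f ->
  forall d e, cle X (val d) (val e) <-> cle Y (val (f d)) (val (f e)).
Proof.
move=> rev bij d e.
rewrite cle_reversible // ?cle_reversible //; try exact: valP.
have inj := bij_inj bij; have [g gK fK] := bij.
split=> H s rs.
  have [|s' s'E] := @seq_preimage X _ (fun d => val (f d)) s.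
    move=> y /(reversible_sub rs) yY; exists (g [` yY]).
    by rewrite fK.
  rewrite -s'E (map_comp val f) !(mem_map val_inj) !(mem_map inj).
  have := H (map val s'); rewrite !(mem_map val_inj); apply.
  by apply/rev; rewrite s'E.
have [|s' s'E] := @seq_preimage X _ val s.
  by move=> y /(reversible_sub rs) yX; exists [` yX].
rewrite -s'E !(mem_map val_inj).
have := H [seq val (f d) | d <- s'].
rewrite (map_comp val f) !(mem_map val_inj) !(mem_map inj); apply.
by rewrite -map_comp; apply/rev; rewrite s'E.
Qed.

(** The injection [g] back provides the cardinality bound that makes the injective [f] bijective. *)
Lemma reversal_map_iso (f : X -> Y) (g : Y -> X) :
  reversal_map f -> injective g -> (forall d, lab (val (f d)) = lab (val d)) ->
  conf_iso X Y.
Proof.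
move=> rev injg labf; have injf := reversal_map_inj rev.
have bij : bijective f by apply: inj_card_bij => //; exact: leq_card injg.
exists f; split=> // d e; rewrite /clt (reversal_map_cle rev bij).
split=> -[le ne]; split=> // E; apply: ne; first by rewrite (injf _ _ (val_inj E)).
by rewrite (val_inj E).
Qed.

End Isomorphism.

(** * Matching transitions by image finiteness *)

Section Matching.
Variables (Act : Type) (Id : choiceType).

Lemma EIL_wh_closed phi : @EIL_wh Act Id phi -> closed phi.
Proof.
rewrite /closed; elim=> {phi} //= [phi psi _ -> _ ->|x a phi _ _ ->].
  by rewrite fsetU0.
by rewrite fset0D.
Qed.

Lemma sat_fi (C : confStruct Act) (X : {fset event C}) (rho rho' : env Id C) phi :
  {in fi phi, rho =1 rho'} -> sat X rho phi <-> sat X rho' phi.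
Proof.
have upd_eq (r r' : env Id C) x e (psi : EIL Act Id) :
    {in fi psi `\ x, r =1 r'} -> {in fi psi, upd r x e =1 upd r' x e}.
  move=> eq_r y yf; rewrite /upd; have [//|yx] := eqVneq y x.
  by apply: eq_r; rewrite !inE yx.
elim: phi X rho rho' => [|phi IH|phi IH1 psi IH2|x a phi IH|x a phi IH|x phi IH]
  X rho rho' eq_rho //=.
- by rewrite (IH X rho rho').
- rewrite (IH1 X rho rho') ?(IH2 X rho rho') // => x xf;
    by apply: eq_rho; rewrite inE xf ?orbT.
- have E X' e := IH X' _ _ (upd_eq rho rho' x e phi eq_rho).
  by split=> -[X' [e [tr le /E s]]]; exists X', e.
- have E X' e := IH X' _ _ (upd_eq rho rho' x e phi eq_rho).
  by split=> -[e [eX le /E s]]; exists e.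
- have eq_phi : {in fi phi, rho =1 rho'}.
    by move=> y yf; apply: eq_rho; rewrite !inE yf orbT.
  have perm X' : permissible rho phi X' <-> permissible rho' phi X'.
    by split=> H y yf; have := H y yf; rewrite eq_phi.
  rewrite -(eq_rho x) ?fset1U1 //.
  by split=> -[X' [e [tr re /perm pe /(IH _ _ _ eq_phi) s]]]; exists X', e.
Qed.

(** If no [a]-successor of [Y] is equivalent to [X'], a formula [phi] holds at [X'] and at none of
    these finitely many successors, so [Dia x a phi] separates [X] from [Y]. *)
Lemma wh_equiv_step (C D : confStruct Act) (X X' : {fset event C})
    (Y : {fset event D}) a : infinite_set [set: Id]%classic -> image_finite D ->
  wh_equiv Id X Y -> atrans X a X' ->
  exists2 Y', atrans Y a Y' & wh_equiv Id X' Y'.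
Proof.
move=> infId finD [cX cY eqv] [d trX lX].
(* [Dia] needs some identifier to bind; an infinite type has one. *)
have [x] : exists x : Id, True.
  apply: contrapT => none; apply: infId.
  rewrite (_ : [set: Id]%classic = set0%classic); first exact: finite_set0.
  by apply/seteqP; split=> // x; case: none; exists x.
move=> _; have [//|none] := pselect (exists2 Y', atrans Y a Y' & wh_equiv Id X' Y').
have [s sE] := proj1 (finite_seqP _) (finD Y a cY).
have cX' : conf C X' by case: trX.
pose P (phi : EIL Act Id) := EIL_wh phi /\ sat X' (env0 C) phi.
pose Q (Y' : {fset event D}) (phi : EIL Act Id) := sat Y' (env0 D) phi.
have [||//||phi [wh satX'] nQ] := @conj_separation Act Id {fset event D} P Q s.
- by split=> //; constructor.
- by move=> phi psi [w1 s1] [w2 s2]; split; [constructor|].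
- move=> Y' Y's.
  have trY : atrans Y a Y'.
    by have : [set` s]%classic Y' by []; rewrite -sE.
  have cY' : conf D Y' by case: trY => e [].
  apply: contrapT => nsep; apply: none; exists Y' => //; split=> // phi wh.
  (* Whichever side satisfies the distinguishing formula, it or its negation holds at [X'] and fails
     at [Y']. *)
  split=> [sX|sY]; apply: contrapT => ns; apply: nsep.
    by exists phi.
  by exists (Neg phi) => //; split=> //; constructor.
have envE (E : confStruct Act) (Z : {fset event E}) (e : event E) :
    sat Z (upd (env0 E) x e) phi <-> sat Z (env0 E) phi.
  by apply: sat_fi => y; rewrite (EIL_wh_closed wh) inE.
have wh_dia : EIL_wh (Dia x a phi).
  by constructor=> //; rewrite (EIL_wh_closed wh) inE.
have /(eqv _ wh_dia)[Y' [e [trY lY /envE sY']]] : sat X (env0 C) (Dia x a phi).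
  by exists X', d; split=> //; apply/envE.
case: (nQ Y') => //.
have : [set Y' | atrans Y a Y']%classic Y' by exists e.
by rewrite sE.
Qed.

End Matching.

Theorem theorem3 (Act : Type) (Id : choiceType)
    (infinite_Id : infinite_set [set: Id]%classic)
    (C D : confStruct Act)
    (stableC : stable C) (stableD : stable D)
    (finC : image_finite C) (finD : image_finite D) :
  WH_bisimilar C D <-> logic_equiv (@EIL_wh Act Id) C D.
Proof.
split=> [[R bisim] phi wh _|eqv].
  have [_ R0 _] := bisim; exact: wh_invariant bisim wh _ _ _ _ R0.
(* Logical equivalence of configurations is itself the bisimulation. *)
exists (wh_equiv Id (C:=C) (D:=D)); split.
- by move=> X Y [].
- by split=> [||phi wh]; [exact: conf0|exact: conf0|apply: eqv (EIL_wh_closed wh)].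
- move=> X Y eqXY a; have eqYX := wh_equiv_sym eqXY.
  have [cX cY _] := eqXY; split.
  + have [f revf labf] := wh_equiv_reversal_map infinite_Id eqXY.
    have [g revg _] := wh_equiv_reversal_map infinite_Id eqYX.
    exact: reversal_map_iso revf (reversal_map_inj stableD cY revg) labf.
  + by move=> X'; apply: wh_equiv_step.
  + move=> Y' /(wh_equiv_step infinite_Id finC eqYX)[X' trX eqv'].
    by exists X' => //; exact: wh_equiv_sym.
Qed.
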